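(* Let $\mathcal{M}=(G=(V,E),\{\phi^e\}_{e\in E})$ be a boolean hypergraphical model with spin value set $S$, $|S|=q$, and let $\boldsymbol{g}=(g_e)_{e\in E}\in\mathbb{C}^{E}$. Then $$Z(\mathcal{M};\boldsymbol{g})=q^{|V|}\,\widetilde{Z}(q,\boldsymbol{v};r_{\mathcal{M}}),\qquad\text{where } v_e=\exp(g_e)-1 \text{ for } e\in E.$$
   Context: A hypergraph $G=(V,E)$ consists of a finite set $V$ of vertices and a finite multiset $E$ of hyperedges, each a finite multiset of elements of $V$ (repeated hyperedges count as distinct elements of $E$). Let $S$ be a finite set with $q=|S|\ge 2$. A hypergraphical model $\mathcal{M}=(G,\{\phi^e\}_{e\in E})$ consists of a hypergraph $G$ and functions $\phi^e\colon S^{V}\to\mathbb{C}$ such that (1) $\phi^e(\boldsymbol{s})=\phi^e(\boldsymbol{s}')$ whenever $\{s_i\}_{i\in e}=\{s'_i\}_{i\in e}$ as multisets, and (2) $\phi^e=\phi^{e'}$ if $e,e'$ are duplicate hyperedges. It is boolean if every $\phi^e$ takes values in $\{0,1\}$. Partition function: $Z(\mathcal{M};\boldsymbol{g})=\sum_{\boldsymbol{s}\in S^V}\prod_{e\in E}\exp(g_e\phi^e(\boldsymbol{s}))$. Counting function: $R_{\mathcal{M}}(A)=\#\{\boldsymbol{s}\in S^V\mid \phi^e(\boldsymbol{s})=1\ \forall e\in A\}$ for $A\subseteq E$. Rank function: $r_{\mathcal{M}}(A)=|V|-\log_q R_{\mathcal{M}}(A)$ if $R_{\mathcal{M}}(A)>0$,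 and $r_{\mathcal{M}}(A)=\infty$ otherwise. For $r\colon 2^E\to\mathbb{R}_{\ge0}\cup\{\infty\}$, the rank generating function is $\widetilde{Z}(q,\boldsymbol{v};r)=\sum_{A\subseteq E}q^{-r(A)}\prod_{e\in A}v_e$, with the convention $q^{-\infty}=0$. *)

(* Defs.v *)
From HB Require Import structures.
From mathcomp Require Import all_boot all_order all_algebra finmap multiset.
From mathcomp Require Import all_classical all_reals all_analysis.
From mathcomp Require Import complex.

Set Implicit Arguments.
Unset Strict Implicit.
Unset Printing Implicit Defensive.

Import Order.TTheory GRing.Theory Num.Theory.

Local Open Scope mset_scope.
Local Open Scope ring_scope.
Local Open Scope complex_scope.

(* The multiset of hyperedges is an indexed family: the elements of [hedge] are
   the hyperedges counted with repetition, [ends e] is the multiset of vertices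
   of [e], and [e], [e'] are duplicates when [ends e = ends e']. *)
Record hypergraph := Hypergraph {
  vertex : finType;
  hedge : finType;
  ends : hedge -> {mset vertex}
}.

Definition config (S : finType) (G : hypergraph) := {ffun vertex G -> S}.

(* {s_i}_{i \in e} as a multiset, with the multiplicities of [e]. *)
Definition edge_spins (S : finType) (G : hypergraph) (s : config S G)
    (e : hedge G) : {mset S} :=
  seq_mset [seq s i | i <- enum_mset (ends e)].

Record hypergraphical_model (R : realType) (S : finType) := HypergraphicalModel {
  graph : hypergraph;
  phi : hedge graph -> config S graph -> R[i];
  phi_local : forall (e : hedge graph) (s s' : config S graph),
    edge_spins s e = edge_spins s' e -> phi e s = phi e s';
  phi_dup : forall e e' : hedge graph, ends e = ends e' -> phi e = phi e'
}.

Definition boolean_model (R : realType) (S : finType)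
    (M : hypergraphical_model R S) : Prop :=
  forall (e : hedge (graph M)) (s : config S (graph M)),
    phi e s = 0 \/ phi e s = 1.

(* The library only has the real exponential. *)
Definition cexp (R : realType) (z : R[i]) : R[i] :=
  let: x +i* y := z in (expR x * cos y) +i* (expR x * sin y).

Definition partition_function (R : realType) (S : finType)
    (M : hypergraphical_model R S) (g : hedge (graph M) -> R[i]) : R[i] :=
  \sum_(s : config S (graph M)) \prod_(e : hedge (graph M)) cexp (g e * phi e s).

Definition counting_function (R : realType) (S : finType)
    (M : hypergraphical_model R S) (A : {set hedge (graph M)}) : nat :=
  #|[set s : config S (graph M) | [forall e in A, phi e s == 1]]|.

Definition rank_function (R : realType) (S : finType)
    (M : hypergraphical_model R S) (A : {set hedge (graph M)}) : \bar R :=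
  if (0 < counting_function A)%N then
    (#|vertex (graph M)|%:R - ln (counting_function A)%:R / ln #|S|%:R)%:E
  else +oo%E.

(* The rank function takes its values in [0, +oo], as the domain of the rank
   generating function below requires. *)
Lemma rank_function_ge0 (R : realType) (S : finType)
    (M : hypergraphical_model R S) (A : {set hedge (graph M)}) :
  (1 < #|S|)%N -> (0 <= rank_function A)%E.
Proof.
move=> S1; rewrite /rank_function; case: ifPn => // c0.
have q1 : 1 < #|S|%:R :> R by rewrite ltr1n.
have cle : (counting_function A <= #|S| ^ #|vertex (graph M)|)%N.
  by rewrite -card_ffun max_card.
rewrite lee_fin subr_ge0 ler_pdivrMr ?ln_gt0// mulr_natl.
rewrite -lnXn ?(lt_trans ltr01)// -natrX ler_ln ?posrE ?ltr0n// ?ler_nat//.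
exact: leq_trans cle.
Qed.

(* q ^ (- x) for [x] in [0, +oo], with q ^ (- oo) = 0; the value at [-oo] is
   irrelevant. *)
Definition pow_opp (R : realType) (q : R) (x : \bar R) : R :=
  if x is x'%:E%E then q `^ (- x') else 0.

Definition rank_generating_function (R : realType) (E : finType) (q : R)
    (v : E -> R[i]) (r : {set E} -> \bar R) : R[i] :=
  \sum_(A : {set E}) (pow_opp q (r A))%:C * \prod_(e in A) v e.

(* Main.v *)
Require Import Defs.
From mathcomp Require Import all_boot all_order all_algebra.
From mathcomp Require Import all_classical all_reals all_analysis.
From mathcomp Require Import complex.

(** The identity is the high-temperature (Fortuin-Kasteleyn) expansion. As
    [phi e s] is 0 or 1, the Boltzmann factor [cexp (g e * phi e s)] equals
    [1 + v e] on the configurations where [phi e s = 1] and [1] elsewhere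
    ([cexp_mul_boolean]). Multiplying out the product over the hyperedges and
    exchanging the two sums, the coefficient of [\prod_(e in A) v e] becomes the
    number of configurations on which every hyperedge of [A] is satisfied, that
    is [counting_function A] ([sum_prod_satisfied]). The rank [r A] is [#|V|]
    minus the base-q logarithm of this count, so [q ^ #|V| * q ^ (- r A)] gives
    the count back ([pow_opp_rank_function]); the value [+oo] is what makes
    this hold when the count is zero. *)

Import Order.TTheory GRing.Theory Num.Theory.

Local Open Scope ring_scope.
Local Open Scope complex_scope.

Lemma cexp0 (R : realType) : cexp (0 : R[i]) = 1.
Proof. by rewrite /cexp /= expR0 cos0 sin0 mulr1 mulr0. Qed.

(** An indicator takes only two values, so any function of it is affine in it.
    With the constant term 1 last, the product of these factors over the
    hyperedges expands into a sum over sets [A] in which the hyperedges outside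
    [A] contribute 1. *)
Lemma cexp_mul_boolean (R : realType) (z x : R[i]) : x = 0 \/ x = 1 ->
  cexp (z * x) = (x == 1)%:R * (cexp z - 1) + 1.
Proof.
case=> ->; first by rewrite mulr0 cexp0 eq_sym oner_eq0 mul0r add0r.
by rewrite mulr1 eqxx mul1r subrK.
Qed.

(** A product of indicators is the indicator of the conjunction, so summing it
    over the configurations counts those that satisfy all of [A]. *)
Lemma sum_prod_satisfied (R : realType) (S : finType)
    (M : hypergraphical_model R S) (v : hedge (graph M) -> R[i])
    (A : {set hedge (graph M)}) :
  \sum_(s : config S (graph M)) \prod_(e in A) ((phi e s == 1)%:R * v e) =
  (counting_function A)%:R * \prod_(e in A) v e.
Proof.
under [LHS]eq_bigr => s _ do rewrite big_split /=.
rewrite -mulr_suml; congr (_ * _).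
rewrite /counting_function -sum1_card natr_sum [RHS]big_mkcond /=.
apply: eq_bigr => s _; rewrite inE.
case: ifPn => [/forall_inP sat | /forall_inPn[e eA /negPf unsat]].
  by rewrite big1 // => e /sat ->.
by rewrite (bigD1 e) //= unsat mul0r.
Qed.

(** Cancelling [#|V|] in the exponent leaves [q ^ (ln c / ln q) = c] for the count
    [c]; this needs [ln q != 0], hence [1 < q], and [0 < c]. For [c = 0] both sides
    vanish. *)
Lemma pow_opp_rank_function (R : realType) (S : finType)
    (M : hypergraphical_model R S) (A : {set hedge (graph M)}) :
  (1 < #|S|)%N ->
  #|S|%:R ^+ #|vertex (graph M)| * pow_opp #|S|%:R (rank_function A) =
  (counting_function A)%:R.
Proof.
move=> S1; rewrite /rank_function.
case: ifPn => [c0 | /=]; last by rewrite -eqn0Ngt => /eqP ->; rewrite mulr0.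
have q1 : 1 < #|S|%:R :> R by rewrite ltr1n.
have q0 : 0 < #|S|%:R :> R by exact: lt_trans q1.
rewrite /= -powR_mulrn ?ltW // -powRD; last by rewrite (gt_eqF q0) implybT.
rewrite opprB addrC subrK /powR (gt_eqF q0) divfK ?gt_eqF ?ln_gt0 //.
by rewrite lnK // posrE ltr0n.
Qed.

Theorem proposition3p4 (R : realType) (S : finType) (hS : (2 <= #|S|)%N)
    (M : hypergraphical_model R S) (hM : boolean_model M)
    (g : hedge (graph M) -> R[i]) :
  partition_function g =
  #|S|%:R ^+ #|vertex (graph M)| *
  rank_generating_function #|S|%:R (fun e : hedge (graph M) => cexp (g e) - 1)
    (@rank_function R S M).
Proof.
rewrite /partition_function.
under [LHS]eq_bigr => s _.
  under eq_bigr => e _ do rewrite cexp_mul_boolean //.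
  rewrite bigA_distr.
  over.
rewrite exchange_big /= /rank_generating_function mulr_sumr.
apply: eq_bigr => A _.
under [LHS]eq_bigr => s _ do rewrite -big_mkcond /=.
rewrite sum_prod_satisfied mulrA; congr (_ * _).
rewrite -(rmorph_nat (real_complex R)) -pow_opp_rank_function //.
by rewrite rmorphM rmorphXn rmorph_nat.
Qed.
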